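(* Consider the algorithm Assort-MNL(BZ) described in the context, run for $T$ iterations with tolerance $\epsilon$ such that $p_1\epsilon^{-1}\in\mathbb N$. Let $P_e$ be the true error probability in each comparison step, $Q_e=1-P_e$, let $\alpha<1/2$ be an upper bound on $P_e$, and $\beta=1-\alpha$. Let $\theta^*=\max_{S\in\mathcal S}f(S)$ be the true optimal revenue, and let $\hat\theta_T$ be the revenue estimate returned by the algorithm. Then after $T$ iterations $$P\big(|\hat\theta_T-\theta^*|>\epsilon\big)\ \le\ \frac{p_1-\epsilon}{\epsilon}\left(\frac{P_e}{2\alpha}+\frac{Q_e}{2\beta}\right)^{T}.$$
   Context: Setting. Items $1,\dots,n$ have nonnegative prices $p_1\ge p_2\ge\dots\ge p_n$; the multinomial logit parameters are $v_0,v_1,\dots,v_n\in[0,1]$ with $v_0>0$. $\mathcal S$ is an arbitrary finite collection of subsets of $\{1,\dots,n\}$ (the feasible assortments). The expected revenue of an assortment $S$ is $f(S)=\frac{\sum_{i\in S}p_iv_i}{v_0+\sum_{i\in S}v_i}$. Algorithm Assort-MNL(BZ). Inputs: the prices, $\epsilon$, $T$ and $\alpha$ (with $\beta=1-\alpha$). Let $m=p_1\epsilon^{-1}$, $I_1=[0,\epsilon]$ and $I_i=(\epsilon(i-1),\epsilon i]$ for $2\le i\le m$. The algorithm maintains a probability vector $a(j)=(a_1(j),\dots,a_m(j))$, representing the posterior distribution on $[0,p_1]$ that has mass $a_i(j)$ spread uniformly on $I_i$. Initialize $a_i(0)=\epsilon/p_1$ for all $i$ and $\hat S=\{1\}$.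 For $j=0,1,\dots,T-1$: (1) Sample selection. Let $u(j)$ be the index with $\sum_{i=1}^{u(j)-1}a_i(j)\le\frac12$ and $\sum_{i=1}^{u(j)}a_i(j)>\frac12$. Put $\tau_1(j)=\sum_{i=u(j)}^{m}a_i(j)-\sum_{i=1}^{u(j)-1}a_i(j)$, $\tau_2(j)=\sum_{i=1}^{u(j)}a_i(j)-\sum_{i=u(j)+1}^{m}a_i(j)$, and $Q(j)=\frac{\tau_2(j)}{\tau_1(j)+\tau_2(j)}$. Set $K_{j+1}=\epsilon(u(j)-1)$ with probability $Q(j)$ and $K_{j+1}=\epsilon\,u(j)$ with probability $1-Q(j)$. (2) Noisy observation. A randomized subroutine (approximate maximum inner product search by a locality sensitive hashing data structure), trying to maximize $\sum_{i\in S}v_i(p_i-K_{j+1})$ over $S\in\mathcal S$, returns some $\tilde S\in\mathcal S$. Set $h(K_{j+1})=1$ if $K_{j+1}\le\frac1{v_0}\sum_{i\in\tilde S}v_i(p_i-K_{j+1})$, and $h(K_{j+1})=0$ otherwise. If $f(\tilde S)>f(\hat S)$, replace $\hat S$ by $\tilde S$. (3) Posterior update. Write $K_{j+1}=\epsilon u$ with $u$ an integer and let $\tau=\sum_{i=1}^{u}a_i(j)-\sum_{i=u+1}^{m}a_i(j)$. For $i\le u$: $a_i(j+1)=a_i(j)\frac{2\beta}{1+\tau(\beta-\alpha)}$ if $h(K_{j+1})=0$, and $a_i(j+1)=a_i(j)\frac{2\alpha}{1-\tau(\beta-\alpha)}$ if $h(K_{j+1})=1$. For $i>u$: $a_i(j+1)=a_i(j)\frac{2\alpha}{1+\tau(\beta-\alpha)}$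 if $h(K_{j+1})=0$, and $a_i(j+1)=a_i(j)\frac{2\beta}{1-\tau(\beta-\alpha)}$ if $h(K_{j+1})=1$. After $T$ iterations let $\theta_T$ be the median of the posterior distribution given by $a(T)$, and return $\hat S$ and $\hat\theta_T=\max(\theta_T,f(\hat S))$. Error model. $P_e$ is the probability of receiving an incorrect answer to the comparison query ''is $K\le\max_{S\in\mathcal S}f(S)$?'' in a comparison step; it is identified with the failure probability of the data structure used by the subroutine, where it is assumed that whenever the data structure does not fail it returns the exact maximizer. A different data structure is queried in every iteration, so that the errors in different iterations are independent of each other.
   Formalization: Adds f({1}) ≤ θ* (automatic when {1} is feasible), since starting from an infeasible Ŝ={1} with larger revenue makes the claim false; also takes α>0, p_1>0 and a nonempty collection of assortments so that the quantities are defined. *)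

(* Defs.v *)
From HB Require Import structures.
From mathcomp Require Import all_boot all_order all_algebra.
From mathcomp Require Import all_classical all_reals all_analysis.

Set Implicit Arguments.
Unset Strict Implicit.
Unset Printing Implicit Defensive.

Import Order.TTheory GRing.Theory Num.Theory.

Local Open Scope classical_set_scope.
Local Open Scope ring_scope.

(* The items 1, ..., n are the elements of 'I_n.+1 shifted down by one (so
   there is at least one item, and item 1 is ord0). *)

Definition revenue (R : realType) (n : nat) (v0 : R) (v p : 'I_n.+1 -> R)
    (S : {set 'I_n.+1}) : R :=
  (\sum_(i in S) p i * v i) / (v0 + \sum_(i in S) v i).

(* Revenues are nonnegative, so the default value 0 of the iterated maximum
   does not matter when SS is nonempty. *)
Definition opt_revenue (R : realType) (n : nat) (v0 : R) (v p : 'I_n.+1 -> R)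
    (SS : {set {set 'I_n.+1}}) : R :=
  \big[Num.max/0]_(S in SS) revenue v0 v p S.

Definition gain (R : realType) (n : nat) (v p : 'I_n.+1 -> R) (K : R)
    (S : {set 'I_n.+1}) : R :=
  \sum_(i in S) v i * (p i - K).

Definition answer (R : realType) (n : nat) (v0 : R) (v p : 'I_n.+1 -> R)
    (K : R) (S : {set 'I_n.+1}) : bool :=
  K <= v0^-1 * gain v p K S.

(* The m bins of the grid are indexed from 0: bin i is the interval I_(i+1),
   and the weight a i is a_(i+1). Hence, for an integer k, the indices "<= k"
   of the 1-based numbering are the i with (i < k)%N. *)

Definition bin (R : realType) (eps : R) (i : nat) : set R :=
  if i is 0%N then `[0, eps]%classic
  else `]eps * i%:R, eps * i.+1%:R]%classic.

Definition mass_below (R : realType) (m : nat) (a : 'I_m -> R) (k : nat) : R :=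
  \sum_(i < m | (i < k)%N) a i.

Definition mass_above (R : realType) (m : nat) (a : 'I_m -> R) (k : nat) : R :=
  \sum_(i < m | (k <= i)%N) a i.

(* w is u(j) - 1 in the 1-based numbering: bin w contains the median. *)
Definition is_pivot (R : realType) (m : nat) (a : 'I_m -> R) (w : nat) : bool :=
  (mass_below a w <= 2^-1) && (2^-1 < mass_below a w.+1).

Definition tau1 (R : realType) (m : nat) (a : 'I_m -> R) (w : nat) : R :=
  mass_above a w - mass_below a w.

Definition tau2 (R : realType) (m : nat) (a : 'I_m -> R) (w : nat) : R :=
  mass_below a w.+1 - mass_above a w.+1.

Definition prob_left (R : realType) (m : nat) (a : 'I_m -> R) (w : nat) : R :=
  tau2 a w / (tau1 a w + tau2 a w).

(* Update after the answer h to the query at the grid point eps * k. *)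
Definition update (R : realType) (m : nat) (alpha : R) (a : 'I_m -> R)
    (k : nat) (h : bool) : 'I_m -> R :=
  let beta := 1 - alpha in
  let tau := mass_below a k - mass_above a k in
  fun i =>
    if (i < k)%N then
      if h then a i * (2 * alpha / (1 - tau * (beta - alpha)))
      else a i * (2 * beta / (1 + tau * (beta - alpha)))
    else
      if h then a i * (2 * beta / (1 - tau * (beta - alpha)))
      else a i * (2 * alpha / (1 + tau * (beta - alpha))).

(* What happens in one iteration: the integer k with K = eps * k, the
   assortment returned by the subroutine, and whether the data structure
   failed. *)
Definition round (m n : nat) : Type :=
  ('I_m.+1 * {set 'I_n.+1} * bool)%type.

Definition query (m n : nat) (r : round m n) : nat := r.1.1.
Definition offered (m n : nat) (r : round m n) : {set 'I_n.+1} := r.1.2.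
Definition failed (m n : nat) (r : round m n) : bool := r.2.

Definition posterior (R : realType) (m n : nat) (v0 : R) (v p : 'I_n.+1 -> R)
    (eps alpha : R) (hs : seq (round m n)) : 'I_m -> R :=
  foldl (fun a r =>
           update alpha a (query r)
             (answer v0 v p (eps * (query r)%:R) (offered r)))
        (fun=> eps / p ord0) hs.

Definition best_assortment (R : realType) (m n : nat) (v0 : R)
    (v p : 'I_n.+1 -> R) (hs : seq (round m n)) : {set 'I_n.+1} :=
  foldl (fun S r => if revenue v0 v p S < revenue v0 v p (offered r)
                    then offered r else S)
        [set ord0]%SET hs.

(* Every bin has length eps, so the uniform distribution on a bin is the
   restricted Lebesgue measure divided by eps. *)
Definition posterior_dist (R : realType) (m : nat) (eps : R) (a : 'I_m -> R)
    (A : set R) : \bar R :=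
  (\sum_(i < m)
     (a i)%:E * ((@lebesgue_measure R) (A `&` bin eps i) * (eps^-1)%:E))%E.

Definition is_median (R : realType) (mu : set R -> \bar R) (x : R) : Prop :=
  ((2^-1)%:E <= mu `]-oo, x]%classic)%E /\
  ((2^-1)%:E <= mu `[x, +oo[%classic)%E.

Definition history (T : Type) (m n : nat) (rd : nat -> T -> round m n)
    (j : nat) (w : T) : seq (round m n) :=
  [seq rd i w | i <- iota 0 j].

(* rd j is iteration j (counted from 0) of a run of length N, with data
   structures of failure probability Pe. What the subroutine returns when it
   fails is unconstrained, apart from being feasible. Independence of the
   data structures is expressed as independence of a failure from everything
   that precedes it, the current query point included; in particular the
   failures of different iterations are independent. *)
Record assort_mnl_bz (R : realType) (d : measure_display)
    (Omega : measurableType d) (P : probability Omega R) (m n N : nat)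
    (v0 : R) (v p : 'I_n.+1 -> R) (SS : {set {set 'I_n.+1}})
    (eps alpha Pe : R) (rd : nat -> Omega -> round m n) : Prop := {
  round_measurable : forall j r, (j < N)%N ->
    measurable [set w | rd j w = r];
  query_left : forall j hs u, (j < N)%N ->
    is_pivot (posterior v0 v p eps alpha hs) u ->
    (P [set w | history rd j w = hs /\ query (rd j w) = u] =
     (prob_left (posterior v0 v p eps alpha hs) u)%:E *
     P [set w | history rd j w = hs])%E;
  query_right : forall j hs u, (j < N)%N ->
    is_pivot (posterior v0 v p eps alpha hs) u ->
    (P [set w | history rd j w = hs /\ query (rd j w) = u.+1] =
     (1 - prob_left (posterior v0 v p eps alpha hs) u)%:E *
     P [set w | history rd j w = hs])%E;
  offered_feasible : forall j w, (j < N)%N -> offered (rd j w) \in SS;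
  offered_exact : forall j w, (j < N)%N -> ~~ failed (rd j w) ->
    forall S, S \in SS ->
    gain v p (eps * (query (rd j w))%:R) S <=
    gain v p (eps * (query (rd j w))%:R) (offered (rd j w));
  failure_prob : forall j, (j < N)%N ->
    P [set w | failed (rd j w)] = Pe%:E;
  failure_indep : forall j hs k, (j < N)%N ->
    (P [set w | [/\ history rd j w = hs, query (rd j w) = k
                  & failed (rd j w)]] =
     P [set w | history rd j w = hs /\ query (rd j w) = k] *
     P [set w | failed (rd j w)])%E
}.

(* Main.v *)
Require Import Defs.
From HB Require Import structures.
From mathcomp Require Import all_boot all_order all_algebra.
From mathcomp Require Import all_classical all_reals all_analysis.
From mathcomp Require Import ring lra.

Set Implicit Arguments.
Unset Strict Implicit.
Unset Printing Implicit Defensive.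

Import Order.TTheory GRing.Theory Num.Theory.

Local Open Scope classical_set_scope.
Local Open Scope ring_scope.

(* Let s be the bin with eps * s <= theta^* < eps * (s + 1) and let V be the
   posterior odds (1 - a_s) / a_s against it. Given the past, the random choice
   between the two endpoints of the median bin makes E[V(j + 1)] at most
   (Pe / (2 alpha) + Qe / (2 beta)) V(j), whatever the position of s; a wrong
   answer requires a failure of the data structure, so its conditional
   probability is at most Pe, and the bound increases with that probability.
   If the median estimate misses the bin s then a_s(T) <= 1/2, that is
   V(T) >= 1, and Markov's inequality applies, with V(0) = (p_1 - eps) / eps. *)

(** * Comparison queries and the optimal revenue *)

Section Revenue.
Context {R : realType} {n : nat} {v0 : R} {v p : 'I_n.+1 -> R}.
Context {SS : {set {set 'I_n.+1}}}.
Hypotheses (hv0 : 0 < v0) (hv : forall i, 0 <= v i) (hp : forall i, 0 <= p i).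

Lemma revenue_den_gt0 (S : {set 'I_n.+1}) : 0 < v0 + \sum_(i in S) v i.
Proof. by rewrite ltr_pwDl// sumr_ge0. Qed.

Lemma gainE (K : R) (S : {set 'I_n.+1}) :
  gain v p K S = \sum_(i in S) p i * v i - K * \sum_(i in S) v i.
Proof.
by rewrite mulr_sumr -sumrB; apply: eq_bigr => i _; rewrite mulrBr !(mulrC (v i)).
Qed.

Lemma answerE (K : R) (S : {set 'I_n.+1}) :
  answer v0 v p K S = (K <= revenue v0 v p S).
Proof.
rewrite /answer /revenue mulrC ler_pdivlMr// ler_pdivlMr ?revenue_den_gt0//.
by rewrite gainE mulrDr lerBrDr.
Qed.

Lemma revenue_le_opt (S : {set 'I_n.+1}) :
  S \in SS -> revenue v0 v p S <= opt_revenue v0 v p SS.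
Proof. by move=> SSS; rewrite /opt_revenue; exact: le_bigmax_cond. Qed.

Lemma opt_revenue_ge0 : 0 <= opt_revenue v0 v p SS.
Proof. exact: bigmax_ge_id. Qed.

(** The positive [v0] in the denominator makes the bound strict; this keeps the optimum strictly
    below the last grid point, hence in one of the [m] bins. *)
Lemma opt_revenue_lt (c : R) :
  0 < c -> (forall i, p i <= c) -> opt_revenue v0 v p SS < c.
Proof.
move=> c0 pc; apply: bigmax_lt => // S _.
rewrite /revenue ltr_pdivrMr ?revenue_den_gt0// mulrDr mulr_sumr.
apply: ltr_pwDl; first exact: mulr_gt0.
by apply: ler_sum => i _; rewrite ler_wpM2r.
Qed.

Lemma answer_le_opt (K : R) (S : {set 'I_n.+1}) :
  S \in SS -> answer v0 v p K S -> K <= opt_revenue v0 v p SS.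
Proof. by rewrite answerE => /revenue_le_opt fS KS; exact: le_trans fS. Qed.

(** If even a maximizer of [gain] fails the test at [K], so does every feasible assortment, and all
    revenues lie below [K]. *)
Lemma answer_maximizer (K : R) (S : {set 'I_n.+1}) :
  0 <= K -> S \in SS ->
  (forall S', S' \in SS -> gain v p K S' <= gain v p K S) ->
  answer v0 v p K S = (K <= opt_revenue v0 v p SS).
Proof.
move=> K0 SSS Smax; apply/idP/idP; first exact: answer_le_opt.
apply: contraTT => SK; rewrite -ltNge.
(* The maximum in [opt_revenue] starts from 0, so bounding it strictly by [K] requires [K > 0]; at
   [K = 0] the answer is always yes. *)
have K_gt0 : 0 < K.
  rewrite lt_neqAle K0 andbT; apply: contraNneq SK => <-.
  rewrite answerE; apply: divr_ge0; last exact/ltW/revenue_den_gt0.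
  by apply: sumr_ge0 => i _; exact: mulr_ge0.
apply: bigmax_lt => // S' S'SS; rewrite ltNge -answerE.
apply: contra SK => /le_trans; apply.
by rewrite ler_pM2l ?invr_gt0// Smax.
Qed.

(** The initial assortment {1} may lie outside [SS], so its revenue is bounded by a separate
    hypothesis. *)
Lemma revenue_best_assortment {m : nat} (hs : seq (round m n)) :
  revenue v0 v p [set ord0]%SET <= opt_revenue v0 v p SS ->
  (forall r, r \in hs -> offered r \in SS) ->
  revenue v0 v p (best_assortment v0 v p hs) <= opt_revenue v0 v p SS.
Proof.
rewrite /best_assortment; elim: hs [set ord0]%SET => //= r hs IH S SS_le hsSS.
apply: IH => [|r' r'hs]; last by rewrite hsSS// inE r'hs orbT.
by case: ifP => // _; rewrite revenue_le_opt// hsSS// mem_head.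
Qed.

End Revenue.

(** * Weight vectors on the grid and the bin of their median *)

Section Weights.
Context {R : realType} {m : nat}.
Implicit Type a : 'I_m -> R.

Lemma mass_below_above a k : mass_below a k + mass_above a k = \sum_i a i.
Proof.
rewrite [RHS](bigID (fun i : 'I_m => (i < k)%N)) /=; congr (_ + _).
by apply: eq_bigl => i; rewrite -leqNgt.
Qed.

Lemma mass_below_ge0 a k : (forall i, 0 < a i) -> 0 <= mass_below a k.
Proof. by move=> a0; apply: sumr_ge0 => i _; exact: ltW. Qed.

Lemma mass_above_ge0 a k : (forall i, 0 < a i) -> 0 <= mass_above a k.
Proof. by move=> a0; apply: sumr_ge0 => i _; exact: ltW. Qed.

Lemma mass_belowS a (w : 'I_m) : mass_below a w.+1 = mass_below a w + a w.
Proof.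
rewrite /mass_below (bigD1 w)//= addrC; congr (_ + _); apply: eq_bigl => i.
by rewrite -val_eqE /= ltnS andbC -ltn_neqAle.
Qed.

Lemma is_pivot_exists a : \sum_i a i = 1 -> exists w : 'I_m, is_pivot a w.
Proof.
move=> a1.
have exw : exists k, 2^-1 < mass_below a k.
  exists m; rewrite /mass_below (eq_bigl xpredT) ?a1; last by move=> i; exact: ltn_ord.
  by lra.
(* The least index with lower mass above 1/2 is one more than the pivot. It is not 0, where the
   lower mass is 0, and not beyond [m], where the lower mass is constant. *)
case: (ex_minnP exw) => -[|w] aw wmin.
  by move: aw; rewrite /mass_below big_pred0//; lra.
have wm : (w < m)%N.
  rewrite ltnNge; apply/negP => mw.
  have /wmin : 2^-1 < mass_below a w.
    apply: lt_le_trans aw _; rewrite le_eqVlt; apply/orP; left; apply/eqP.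
    apply: eq_bigl => i; have im := leq_trans (ltn_ord i) mw.
    by rewrite im ltnW.
  by rewrite ltnn.
exists (Ordinal wm); rewrite /is_pivot aw andbT leNgt; apply/negP => /wmin.
by rewrite ltnn.
Qed.

(** * Bayesian update and the one-step contraction of the odds *)

Section Update.
Context {alpha : R} (halpha : 0 < alpha < 2^-1).
Context {a : 'I_m -> R} (a_gt0 : forall i, 0 < a i) (a1 : \sum_i a i = 1).

(* The imbalance of the weights at the query point [k], signed so that it is
   positive when the majority of the mass is on the side not containing [s]. *)
Let x k (s : 'I_m) : R :=
  (if (k <= s)%N then 1 else -1) * (mass_below a k - mass_above a k).

Lemma imbalance_bound k : `|mass_below a k - mass_above a k| <= 1.
Proof.
have := mass_below_above a k; rewrite a1.
have := mass_below_ge0 k a_gt0; have := mass_above_ge0 k a_gt0.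
by rewrite ler_norml; lra.
Qed.

Lemma update_den_gt0 k :
  (0 < 1 + (mass_below a k - mass_above a k) * (1 - alpha - alpha)) /\
  (0 < 1 - (mass_below a k - mass_above a k) * (1 - alpha - alpha)).
Proof.
have := imbalance_bound k; rewrite ler_norml; move: halpha.
by move: (_ - _) => t /andP[? ?] /andP[? ?]; split; nra.
Qed.

Lemma update_gt0 k h i : 0 < update alpha a k h i.
Proof.
have [D0 D1] := update_den_gt0 k; have /andP[al0 al1] := halpha.
have be0 : 0 < 1 - alpha by lra.
rewrite /update; case: ifP => _; case: h; rewrite mulr_gt0// divr_gt0// mulr_gt0//.
Qed.

(** Since the weights sum to 1, half of each denominator is [beta * B + alpha * A] (answer no) or
    [alpha * B + beta * A] (answer yes), with [B] and [A] the masses below and above [k]: the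
    normalizing constant of Bayes' rule. *)
Lemma sum_update k h : \sum_i update alpha a k h i = 1.
Proof.
have [D0 D1] := update_den_gt0 k; have := mass_below_above a k.
rewrite a1 (bigID (fun i : 'I_m => (i < k)%N)) /= /update.
move: D0 D1; set B := mass_below a k; set A := mass_above a k => D0 D1 BA.
have Ek : forall c, \sum_(i < m | (i < k)%N) a i * c = B * c by move=> c; rewrite -mulr_suml.
have El : forall c, \sum_(i < m | ~~ (i < k)%N) a i * c = A * c.
  by move=> c; rewrite -mulr_suml /A; congr (_ * _); apply: eq_bigl => i; rewrite -leqNgt.
under eq_bigr => i ik do rewrite ik.
under [X in _ + X]eq_bigr => i ik do rewrite (negbTE ik).
have AE : A = 1 - B by lra.
case: h; rewrite Ek El; move: D0 D1; rewrite AE => D0 D1; field; exact: lt0r_neq0.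
Qed.

(** [(k <= s)%N] is the right answer for an optimum in bin [s], so [a s] gets the factor with
    [2 * beta]. The sign in [x] merges both positions of [s] into one formula. *)
Lemma inv_update_right k (s : 'I_m) :
  (update alpha a k (k <= s)%N s)^-1 =
  (a s)^-1 * ((1 - x k s * (1 - alpha - alpha)) / (2 * (1 - alpha))).
Proof.
have [D0 D1] := update_den_gt0 k; have /andP[al0 al1] := halpha.
have be0 : 1 - alpha != 0 by apply: lt0r_neq0; lra.
have as0 : a s != 0 by exact: lt0r_neq0.
have {}D0 := lt0r_neq0 D0; have {}D1 := lt0r_neq0 D1.
rewrite /update /x ltnNge; move: D0 D1; move: (_ - mass_above _ _) => t D0 D1.
by case: (k <= s)%N => /=; rewrite ?mulN1r ?mulNr ?opprK ?mul1r; field; rewrite as0 be0.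
Qed.

Lemma inv_update_wrong k (s : 'I_m) :
  (update alpha a k (~~ (k <= s)%N) s)^-1 =
  (a s)^-1 * ((1 + x k s * (1 - alpha - alpha)) / (2 * alpha)).
Proof.
have [D0 D1] := update_den_gt0 k; have /andP[al0 al1] := halpha.
have be0 : alpha != 0 by apply: lt0r_neq0.
have as0 : a s != 0 by exact: lt0r_neq0.
have {}D0 := lt0r_neq0 D0; have {}D1 := lt0r_neq0 D1.
rewrite /update /x ltnNge; move: D0 D1; move: (_ - mass_above _ _) => t D0 D1.
by case: (k <= s)%N => /=; rewrite ?mulN1r ?mulNr ?mul1r; field; rewrite as0 be0.
Qed.

(** Clearing denominators reduces this to [-1 <= x k s]. It allows a failed data structure, whose
    answer may still be right, to be charged as if it were wrong. *)
Lemma inv_update_right_le_wrong k (s : 'I_m) :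
  (update alpha a k (k <= s)%N s)^-1 <= (update alpha a k (~~ (k <= s)%N) s)^-1.
Proof.
have /andP[al0 al1] := halpha.
rewrite inv_update_right inv_update_wrong ler_pM2l ?invr_gt0//.
have : `|x k s| <= 1.
  rewrite /x normrM; case: ifP => _; rewrite ?normrN normr1 mul1r imbalance_bound//.
rewrite ler_norml => /andP[x1 x2].
rewrite ler_pdivrMr; last by lra.
rewrite [leRHS]mulrAC ler_pdivlMr; last by lra.
by nra.
Qed.

(* The randomization averages [x] over the two query points to 0 when [s] is
   not the pivot, and to [- tau1 * tau2 / a w >= - a w] (AM-GM) when it is. *)
Lemma bz_step (Pe : R) (s w : 'I_m) (H : nat -> R) :
  0 <= Pe <= alpha -> is_pivot a w ->
  (forall k, H k = (1 - Pe) * ((update alpha a k (k <= s)%N s)^-1 - 1) +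
                   Pe * ((update alpha a k (~~ (k <= s)%N) s)^-1 - 1)) ->
  prob_left a w * H w + (1 - prob_left a w) * H w.+1 <=
  (Pe / (2 * alpha) + (1 - Pe) / (2 * (1 - alpha))) * ((a s)^-1 - 1).
Proof.
move=> hPe /andP[w1 w2] HE0.
have /andP[al0 al1] := halpha.
have aw := a_gt0 w; have as0 := a_gt0 s.
have e0 := mass_below_above a w; have e1 := mass_below_above a w.+1.
have e2 := mass_belowS a w; rewrite a1 in e0 e1.
set r := _ / _ + _ / _.
have al_n0 : alpha != 0 by exact: lt0r_neq0.
have be_n0 : 1 - alpha != 0 by apply: lt0r_neq0; lra.
have as_n0 : a s != 0 by exact: lt0r_neq0.
(* This is where [Pe <= alpha] enters. *)
have r1 : 0 <= 1 - r.
  rewrite subr_ge0 /r.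
  have -> : Pe / (2 * alpha) + (1 - Pe) / (2 * (1 - alpha)) =
      1 - (alpha - Pe) * (1 - alpha - alpha) / (2 * alpha * (1 - alpha)).
    by field; rewrite al_n0 be_n0.
  rewrite gerBl divr_ge0// mulr_ge0//; by lra.
(* [H] is affine in [x], with slope proportional to [1 - r], so only the average of [x] over the two
   query points matters. *)
have HE : forall k, H k = r * (a s)^-1 - 1 - (a s)^-1 * x k s * (1 - r).
  move=> k; rewrite HE0 inv_update_right inv_update_wrong /r; field.
  by rewrite al_n0 be_n0 as_n0.
rewrite !HE; set q := prob_left a w.
suff : -1 <= (a s)^-1 * (q * x w s + (1 - q) * x w.+1 s).
  move/(ler_wpM2r r1); rewrite -subr_ge0 => h; rewrite -subr_ge0.
  by apply: le_trans h _; rewrite le_eqVlt; apply/orP; left; apply/eqP; ring.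
rewrite /q /x /prob_left /tau1 /tau2; move: w1 w2 e0 e1 e2.
move: (mass_below a w) (mass_above a w) (mass_below a w.+1) (mass_above a w.+1).
move=> B A B' A' w1 w2 e0 e1 e2; clear HE HE0 q.
have EA : A = 1 - B by lra.
have EA' : A' = 1 - B - a w by lra.
rewrite {}EA {}EA' {}e2 in w2 *.
have D0 : 1 - B - B + (B + a w - (1 - B - a w)) != 0 by apply: lt0r_neq0; lra.
case: (ltngtP w s) => ws /=.
- rewrite [X in _ <= _ * X](_ : _ = 0) ?mulr0 ?lerN10//.
  by field.
- rewrite [X in _ <= _ * X](_ : _ = 0) ?mulr0 ?lerN10//.
  by field.
- rewrite -(val_inj ws); rewrite [X in _ <= _ * X]
    (_ : _ = - ((1 - 2 * B) * (2 * (B + a w) - 1)) / a w); last first.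
    by field; rewrite D0 lt0r_neq0.
  rewrite mulrC -mulrA -invfM ler_pdivlMr ?mulr_gt0//.
  (* Here [tau1 + tau2 = 2 * a w], and [1 - 2 * B - a w] is half of [tau1 - tau2]; the square yields
     [tau1 * tau2 <= a w ^+ 2]. *)
  have := sqr_ge0 (1 - 2 * B - a w); nra.
Qed.

End Update.
End Weights.

(** * Mass and medians of the posterior distribution *)

Section Median.
Context {R : realType} {m : nat} {eps : R} (heps : 0 < eps).

Lemma measurable_bin i : measurable (bin eps i).
Proof. by case: i => [|i]; exact: measurable_itv. Qed.

Lemma bin_closed_itv i x : bin eps i x -> eps * i%:R <= x <= eps * i.+1%:R.
Proof.
case: i => [|i]; rewrite /bin /= in_itv/= ?mulr0 ?mulr1//.
by move=> /andP[/ltW -> ->].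
Qed.

Lemma itv_bin i x : eps * i%:R < x <= eps * i.+1%:R -> bin eps i x.
Proof.
case: i => [|i]; rewrite /bin /= in_itv/= ?mulr0 ?mulr1//.
by move=> /andP[/ltW -> ->].
Qed.

Lemma lebesgue_measure_bin i : @lebesgue_measure R (bin eps i) = eps%:E.
Proof.
case: i => [|i]; rewrite /bin lebesgue_measure_itv/= lte_fin.
  by rewrite heps oppr0 addr0.
rewrite ltr_pM2l// ltr_nat ltnSn; congr EFin.
by rewrite -mulrBr -natrB// subSnn mulr1.
Qed.

Context {a : 'I_m -> R} (a_gt0 : forall i, 0 < a i) (a1 : \sum_i a i = 1).
Let mu := posterior_dist eps a.

Let term_ge0 (A : set R) (i : 'I_m) :
  (0 <= (a i)%:E * (lebesgue_measure (A `&` bin eps i) * (eps^-1)%:E))%E.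
Proof. by rewrite !mule_ge0// ?lee_fin ?invr_ge0 ltW. Qed.

Lemma posterior_distU A B : measurable A -> measurable B -> A `&` B = set0 ->
  mu (A `|` B) = (mu A + mu B)%E.
Proof.
move=> mA mB AB; rewrite /mu /posterior_dist -big_split/=; apply: eq_bigr => i _.
have mb := measurable_bin i.
rewrite setIUl measureU//; [|exact: measurableI..|by rewrite setIACA AB set0I].
by rewrite ge0_muleDl// ge0_muleDr// mule_ge0// lee_fin invr_ge0 ltW.
Qed.

Lemma posterior_dist_ge0 A : (0 <= mu A)%E.
Proof. by apply: sume_ge0 => i _; exact: term_ge0. Qed.

Lemma posterior_dist_setT : mu setT = 1%E.
Proof.
rewrite /mu /posterior_dist -a1 -sumEFin; apply: eq_bigr => i _.
by rewrite setTI lebesgue_measure_bin -!EFinM divff ?mulr1// lt0r_neq0.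
Qed.

Lemma posterior_dist_disjoint A B : measurable A -> measurable B ->
  A `&` B = set0 -> (mu A + mu B <= 1)%E.
Proof.
move=> mA mB AB; have mU : measurable (A `|` B) by exact: measurableU.
rewrite -posterior_dist_setT -(setUv (A `|` B)) posterior_distU ?setICr//.
  by rewrite -posterior_distU// leeDl// posterior_dist_ge0.
exact: measurableC.
Qed.

Lemma posterior_dist_le_half A B : measurable A -> measurable B ->
  A `&` B = set0 -> ((2^-1)%:E <= mu A)%E -> (mu B <= (2^-1)%:E)%E.
Proof.
move=> mA mB AB halfA; have AB1 := posterior_dist_disjoint mA mB AB.
rewrite -(leeD2lE (x := (2^-1)%:E))// -EFinD (_ : 2^-1 + 2^-1 = 1 :> R); last by lra.
by apply: le_trans AB1; exact: leeD2r.
Qed.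

Lemma posterior_dist_bin i : ((a i)%:E <= mu (bin eps i))%E.
Proof.
rewrite /mu /posterior_dist (bigD1 i)//= setIid lebesgue_measure_bin -!EFinM.
by rewrite divff ?lt0r_neq0// mulr1 leeDl// sume_ge0.
Qed.

Lemma posterior_dist_eq0 A (i : 'I_m) :
  (mu A <= 0)%E -> lebesgue_measure (A `&` bin eps i) = 0%E.
Proof.
rewrite /mu /posterior_dist (bigD1 i)//= => A0; apply/eqP; rewrite eq_le measure_ge0 andbT.
have : ((a i)%:E * (lebesgue_measure (A `&` bin eps i) * (eps^-1)%:E) <= 0)%E.
  by apply: le_trans A0; rewrite leeDl// sume_ge0.
by rewrite pmule_rle0 ?lte_fin// pmule_lle0// lte_fin invr_gt0.
Qed.

Lemma posterior_dist_avoids_bins A :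
  (forall i : 'I_m, A `&` bin eps i = set0) -> mu A = 0%E.
Proof.
by move=> A0; rewrite /mu /posterior_dist big1// => i _; rewrite A0 measure0 mul0e mule0.
Qed.

(** Disjoint sets have total mass at most 1, so a half-line of mass at least 1/2 must meet a bin of
    mass above 1/2. *)
Lemma median_in_bin (s : 'I_m) x : 2^-1 < a s -> is_median mu x ->
  eps * s%:R <= x <= eps * s.+1%:R.
Proof.
move=> as_gt [xl xr]; have mb := measurable_bin s.
have key A : measurable A -> ((2^-1)%:E <= mu A)%E -> A `&` bin eps s <> set0.
  move=> mA hA A0; have := posterior_dist_le_half mA mb A0 hA.
  move/(le_trans (posterior_dist_bin s)); rewrite lee_fin; lra.
apply/andP; split; rewrite leNgt; apply/negP => xs.
  apply: (key _ _ xl); first exact: measurable_itv.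
  rewrite -subset0 => y [] /=; rewrite in_itv/= => yx /bin_closed_itv; lra.
apply: (key _ _ xr); first exact: measurable_itv.
rewrite -subset0 => y [] /=; rewrite in_itv/= andbT => yx /bin_closed_itv; lra.
Qed.

(* Makes the estimate a function of the history, hence measurable. *)
Lemma median_unique x y : is_median mu x -> is_median mu y -> x = y.
Proof.
wlog xy : x y / x < y.
  move=> H mx my; case: (ltgtP x y) => // xy; first exact: H.
  by apply/esym; exact: H.
move=> [xl _] [_ yr]; exfalso.
have nat_grid (i : 'I_m) : i.+1%:R <= m%:R :> R by rewrite ler_nat.
have x0 : 0 <= x.
  rewrite leNgt; apply/negP => x0; move: xl; rewrite posterior_dist_avoids_bins ?lee_fin.
    by rewrite invr_le0; lra.
  move=> i; rewrite -subset0 => z [] /=; rewrite in_itv/= => zx /bin_closed_itv.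
  have : 0 <= eps * i%:R by rewrite mulr_ge0// ltW.
  by lra.
have ym : y <= eps * m%:R.
  rewrite leNgt; apply/negP => ym; move: yr; rewrite posterior_dist_avoids_bins ?lee_fin.
    by rewrite invr_le0; lra.
  move=> i; rewrite -subset0 => z [] /=; rewrite in_itv/= andbT => zx /bin_closed_itv.
  have := nat_grid i; rewrite -(ler_pM2l heps); lra.
(* The two half-lines already carry mass 1, leaving none for the gap between the medians. *)
have C0 : (mu `]x, y[%classic <= 0)%E.
  have AB0 : `]-oo, x]%classic `&` `[y, +oo[%classic = set0 :> set R.
    by rewrite -subset0 => z [] /=; rewrite !in_itv/= andbT; lra.
  have ABC0 : (`]-oo, x]%classic `|` `[y, +oo[%classic) `&` `]x, y[%classic = set0 :> set R.
    by rewrite -subset0 => z [] /=; rewrite !in_itv/= andbT; lra.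
  have mAB : measurable (`]-oo, x]%classic `|` `[y, +oo[%classic : set R).
    by apply: measurableU; exact: measurable_itv.
  have := posterior_dist_disjoint mAB (measurable_itv _) ABC0.
  rewrite posterior_distU//; [|exact: measurable_itv..] => le1.
  rewrite -(leeD2lE (x := 1%E))// adde0; apply: le_trans le1.
  apply: leeD2r; rewrite (_ : 1%E = (2^-1)%:E + (2^-1)%:E)%E; first exact: leeD.
  by rewrite -EFinD; congr EFin; lra.
(* Let [i] be the bin with [eps * i <= x < eps * i.+1]. The part of the gap just to the right of [x]
   stays in bin [i] and has positive length, against the null mass. *)
have /andP[ix xi] := truncn_itv (divr_ge0 x0 (ltW heps)).
move: ix xi; set i := Num.truncn _; rewrite ler_pdivlMr// ltr_pdivrMr// => ix xi.
have im : (i < m)%N.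
  rewrite -(ltr_nat R) -(ltr_pM2r heps); apply: le_lt_trans ix _.
  by rewrite mulrC; exact: lt_le_trans ym.
have := posterior_dist_eq0 (Ordinal im) C0; apply/eqP; rewrite gt_eqF//=.
pose D : set R := `]x, Num.min y (eps * i.+1%:R)[%classic.
have : D `<=` `]x, y[%classic `&` bin eps i.
  move=> z; rewrite /D /= in_itv/= lt_min => /and3P[xz zy zi]; split.
    by rewrite in_itv/= xz.
  by apply: itv_bin; rewrite (ltW zi) andbT; apply: le_lt_trans xz; rewrite mulrC.
move=> DC.
have D0 : (0 < @lebesgue_measure R D)%E.
  have xD : x < Num.min y (eps * i.+1%:R) by rewrite lt_min xy mulrC.
  by rewrite /D lebesgue_measure_itv/= lte_fin xD lte_fin subr_gt0.
apply: (lt_le_trans D0); apply: le_measure => //; rewrite inE.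
  exact: measurable_itv.
by apply: measurableI; [exact: measurable_itv|exact: measurable_bin].
Qed.

End Median.

(** * Events split over the values of a finite-valued variable *)

Lemma fine_measure_fibers (R : realType) (d : measure_display)
    (Omega : measurableType d) (P : probability Omega R) (F : finType)
    (X : Omega -> F) (B : set Omega) (Q : pred F) :
  measurable B -> (forall x, measurable [set w | X w = x]) ->
  fine (P [set w | B w /\ Q (X w)]) =
  \sum_(x | Q x) fine (P [set w | B w /\ X w = x]).
Proof.
move=> mB mX; have mBX x : measurable [set w | B w /\ X w = x].
  exact: (measurableI B [set w | X w = x]).
rewrite sum_fine; last by move=> x _; exact: fin_num_measure.
rewrite -big_enum (fsbig_seq _ _ (enum_uniq Q)) -measure_fin_bigcup//.
  congr (fine (P _)); apply/seteqP; split => w /=.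
    by move=> [Bw Qw]; exists (X w) => //=; rewrite mem_enum.
  by move=> [x]; rewrite /= mem_enum => Qx [Bw ->].
by move=> x y _ _ [w [/= [_ <-] [_ <-]]].
Qed.

Lemma measurable_preimage_finType (d : measure_display)
    (Omega : measurableType d) (F : finType) (X : Omega -> F) (Q : set F) :
  (forall x, measurable [set w | X w = x]) -> measurable [set w | Q (X w)].
Proof.
move=> mX; rewrite (_ : mkset _ = \bigcup_(x in Q) [set w | X w = x]).
  by apply: fin_bigcup_measurable => [|x _]; first exact: finite_finset.
by apply/seteqP; split => [w Qw|w [x Qx /= ->]//]; exists (X w).
Qed.

Lemma history_rS (T : Type) (m n : nat) (rd : nat -> T -> round m n) j w :
  history rd j.+1 w = rcons (history rd j w) (rd j w).
Proof. by rewrite /history -addn1 iotaD map_cat cats1. Qed.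

(** * Evolution of the odds along a run *)

Section Run.
Context {R : realType} {n m N : nat} {v0 : R} {v p : 'I_n.+1 -> R}.
Context {SS : {set {set 'I_n.+1}}} {eps alpha Pe : R}.
Context {d : measure_display} {Omega : measurableType d}.
Context {P : probability Omega R} {rd : nat -> Omega -> round m n}.
Hypotheses (hv0 : 0 < v0) (hv : forall i, 0 <= v i) (hp : forall i, 0 <= p i).
Hypotheses (heps : 0 < eps) (hm : (0 < m)%N) (hgrid : p ord0 = eps * m%:R).
Hypotheses (halpha : 0 < alpha < 2^-1) (hPe : 0 <= Pe <= alpha).
Hypothesis hrun : assort_mnl_bz P N v0 v p SS eps alpha Pe rd.

Let post := @posterior R m n v0 v p eps alpha.
Let pr (A : set Omega) := fine (P A).
Let rate := Pe / (2 * alpha) + (1 - Pe) / (2 * (1 - alpha)).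

Lemma posterior_rcons hs r :
  post (rcons hs r) = update alpha (post hs) (query r)
    (answer v0 v p (eps * (query r)%:R) (offered r)).
Proof. by rewrite /post /posterior foldl_rcons. Qed.

Lemma posterior_spec hs : (forall i, 0 < post hs i) /\ \sum_i post hs i = 1.
Proof.
elim/last_ind: hs => [|hs r [pos1 sum1]].
  have p0 : 0 < p ord0 by rewrite hgrid mulr_gt0// ltr0n.
  split=> [i|]; first exact: divr_gt0.
  rewrite sumr_const card_ord -[LHS]mulr_natr mulrAC -hgrid divff//.
  exact: lt0r_neq0.
rewrite posterior_rcons; split => [i|]; [exact: update_gt0|exact: sum_update].
Qed.

(** The event is a finite union over the last round, which the induction absorbs into the arbitrary
    [A]. *)
Lemma measurable_history j (A : set (seq (round m n))) : (j <= N)%N ->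
  measurable [set w | A (history rd j w)].
Proof.
elim: j A => [|j IH] A jN.
  rewrite /history/=; have [A0|A0] := pselect (A [::]).
    by rewrite (_ : mkset _ = setT)//; apply/seteqP; split.
  by rewrite (_ : mkset _ = set0)//; apply/seteqP; split.
rewrite (_ : mkset _ = \bigcup_(r in setT)
    ([set w | A (rcons (history rd j w) r)] `&` [set w | rd j w = r])).
  apply: fin_bigcup_measurable => [|r _]; first exact: finite_finset.
  apply: measurableI; last exact: (round_measurable hrun).
  exact: (IH (fun hs => A (rcons hs r)) (ltnW jN)).
apply/seteqP; split => w /=; rewrite history_rS.
  by move=> Aw; exists (rd j w).
by move=> [r _ [/= Ar ->]].
Qed.

Variable s : 'I_m.
Hypothesis hs_opt :
  eps * s%:R <= opt_revenue v0 v p SS < eps * s.+1%:R.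

Let V hs := (post hs s)^-1 - 1.

Lemma odds_ge0 hs : 0 <= V hs.
Proof.
have [pos sum1] := posterior_spec hs; rewrite subr_ge0 invf_ge1//.
by rewrite -sum1 (bigD1 s)//= lerDl sumr_ge0// => i _; exact: ltW.
Qed.

Lemma grid_le_opt (k : nat) :
  (eps * k%:R <= opt_revenue v0 v p SS) = (k <= s)%N.
Proof.
have /andP[s_le lt_s] := hs_opt; apply/idP/idP => [k_le|ks].
  by rewrite -ltnS -(ltr_nat R) -(ltr_pM2l heps); exact: le_lt_trans lt_s.
by apply: le_trans s_le; rewrite ler_pM2l// ler_nat.
Qed.

(** A conditional expectation bound multiplied by the probability of the past, so that histories of
    probability 0 need no special care. *)
Lemma odds_step (hs : seq (round m n)) j : (j < N)%N ->
  \sum_(r : round m n) V (rcons hs r) * pr [set w | history rd j w = hs /\ rd j w = r] <=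
  rate * V hs * pr [set w | history rd j w = hs].
Proof.
move=> jN; set B := [set w | history rd j w = hs]; set a := post hs.
have [a_gt0 a1] : (forall i, 0 < a i) /\ \sum_i a i = 1 := posterior_spec hs.
have mB : measurable B := measurable_history (fun h => h = hs) (ltnW jN).
have mrd r : measurable [set w | rd j w = r].
  exact: (round_measurable hrun r jN).
have pr_fib Q := fine_measure_fibers P Q mB mrd.
(* Odds after a query at [k], answered rightly if [b] is false and wrongly if [b] is true. *)
pose G (k : nat) (b : bool) := (update alpha a k (b (+) (k <= s)%N) s)^-1 - 1.
have VG r : V (rcons hs r) * pr [set w | B w /\ rd j w = r] <=
    G (query r) (failed r) * pr [set w | B w /\ rd j w = r].
  (* Feasibility and exactness are known only at sample points, so a round that is never attained is
     discarded through its zero probability. *)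
  have [->|] := eqVneq (pr [set w | B w /\ rd j w = r]) 0; first by rewrite !mulr0.
  case: (pselect (exists w, rd j w = r)) => [[w rw] _|norw]; last first.
    rewrite (_ : [set w | _] = set0) /pr ?measure0 ?eqxx//.
    by rewrite -subset0 => w [_ rw]; apply: norw; exists w.
  apply: ler_wpM2r; first exact/fine_ge0/measure_ge0.
  rewrite /V posterior_rcons -/a /G lerD2r -rw.
  have Sfeas := offered_feasible hrun w jN.
  case: (boolP (failed (rd j w))) => [_|nf] /=; last first.
    rewrite (answer_maximizer hv0 hv hp _ Sfeas) ?grid_le_opt//.
      by rewrite mulr_ge0// ltW.
    exact: (offered_exact hrun jN nf).
  case: answer; case: (query (rd j w) <= s)%N (inv_update_right_le_wrong halpha a_gt0 a1 (query (rd j w)) s) => //=.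
apply: le_trans (ler_sum _ (fun r _ => VG r)) _ => {VG}.
pose q (k : nat) := pr [set w | B w /\ query (rd j w) = k].
have mq (k : nat) : measurable [set w | B w /\ query (rd j w) = k].
  apply: (measurableI B [set w | query (rd j w) = k]) => //.
  exact: (measurable_preimage_finType (fun r => query r = k)).
have mfail : measurable [set w | failed (rd j w)].
  exact: (measurable_preimage_finType (fun r => failed r)).
have q_sum (k : nat) : q k = \sum_(r | query r == k) pr [set w | B w /\ rd j w = r].
  rewrite -pr_fib; congr (fine (P _)); apply/seteqP; split => w /=.
    by move=> [? ->].
  by move=> [? /eqP].
(* A failure is independent of the past and the query point together, so it takes the fraction [Pe]
   of each [q k]. *)
have q_fail (k : nat) :
    \sum_(r | (query r == k) && failed r) pr [set w | B w /\ rd j w = r] = Pe * q k.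
  have := congr1 fine (failure_indep hrun hs k jN).
  rewrite (failure_prob hrun jN) fineM//=; last exact: fin_num_measure.
  rewrite mulrC => <-; rewrite -(pr_fib (fun r => (query r == k) && failed r)).
  congr (fine (P _)); apply/seteqP; split => w /=.
    by move=> [? /andP[/eqP]].
  by move=> [? -> ->]; rewrite eqxx.
pose H (k : nat) := (1 - Pe) * G k false + Pe * G k true.
have -> : \sum_r G (query r) (failed r) * pr [set w | B w /\ rd j w = r] =
    \sum_(k < m.+1) q k * H k.
  rewrite (partition_big (fun r : round m n => r.1.1) xpredT)//=.
  apply: eq_bigr => k _.
  have -> : q k * H k = G k false * (q k - Pe * q k) + G k true * (Pe * q k).
    by rewrite /H; ring.
  rewrite -q_fail q_sum [X in _ * (X - _)](bigID (@failed m n))/= addrAC subrr add0r.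
  rewrite (bigID (@failed m n))/= addrC !mulr_sumr.
  by congr (_ + _); apply: eq_bigr => r /andP[/eqP <-];
    [move/negbTE ->|move=> ->].
have q_ge0 k : 0 <= q k by exact/fine_ge0/measure_ge0.
have [w piv] := is_pivot_exists a1.
have qw : q w = prob_left a w * pr B.
  by have := congr1 fine (query_left hrun jN piv); rewrite fineM//= fin_num_measure.
have qw1 : q w.+1 = (1 - prob_left a w) * pr B.
  by have := congr1 fine (query_right hrun jN piv); rewrite fineM//= fin_num_measure.
have q_total : \sum_(k < m.+1) q k = pr B.
  transitivity (\sum_r pr [set w | B w /\ rd j w = r]).
    rewrite (partition_big (fun r : round m n => r.1.1) xpredT)//=.
    by apply: eq_bigr => k _; rewrite q_sum.
  rewrite -(pr_fib xpredT); congr (fine (P _)).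
  by apply/seteqP; split => x /= => [[]|].
have wm := ltn_ord w.
pose k0 : 'I_m.+1 := Ordinal (ltnW wm : (w < m.+1)%N).
pose k1 : 'I_m.+1 := Ordinal (wm : (w.+1 < m.+1)%N).
have k01 : k1 != k0 by rewrite -val_eqE /= neq_ltn ltnSn orbT.
(* The endpoints of the pivot bin already account for all of [pr B]. *)
have q_rest (k : 'I_m.+1) : k != k0 -> k != k1 -> q k = 0.
  move=> kk0 kk1; have := q_total.
  rewrite (bigD1 k0)//= (bigD1 k1)//= (bigD1 k) ?kk0//= qw qw1 => q_eq.
  apply/eqP; rewrite eq_le q_ge0 andbT.
  have : 0 <= \sum_(i < m.+1 | (i != k0) && (i != k1) && (i != k)) q i by exact: sumr_ge0.
  lra.
rewrite (bigD1 k0)//= (bigD1 k1)//= big1 ?addr0; last first.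
  by move=> k /andP[kk0 kk1]; rewrite q_rest ?mul0r.
rewrite qw qw1 mulrAC [X in _ + X]mulrAC -mulrDl ler_wpM2r//.
  exact/fine_ge0/measure_ge0.
exact: (bz_step halpha a_gt0 a1 (s := s) (H := H) hPe piv (fun k => erefl)).
Qed.

Lemma rate_ge0 : 0 <= rate.
Proof.
have /andP[? ?] := halpha; have /andP[? ?] := hPe.
by rewrite addr_ge0// divr_ge0//; lra.
Qed.

(* Markov's inequality for the odds, by induction on the number [l] of rounds
   that remain after the history [hs]. *)
Lemma tail_bound (A : set (seq (round m n))) l j (hs : seq (round m n)) :
  (forall hs, A hs -> 1 <= V hs) -> (j + l)%N = N ->
  pr [set w | history rd j w = hs /\ A (history rd N w)] <=
  rate ^+ l * V hs * pr [set w | history rd j w = hs].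
Proof.
move=> AV; elim: l j hs => [|l IH] j hs jlN.
  (* With no round left, the event is empty or is all of [history rd N w = hs] with [1 <= V hs]. *)
  rewrite addn0 in jlN; rewrite jlN expr0 mul1r.
  have [Ahs|nAhs] := pselect (A hs).
    rewrite (_ : [set w | _ /\ _] = [set w | history rd N w = hs]).
      by rewrite ler_peMl ?AV//; exact/fine_ge0/measure_ge0.
    by apply/seteqP; split => w /= => [[]|->].
  rewrite (_ : [set w | _ /\ _] = set0) /pr.
    by rewrite measure0 mulr_ge0 ?odds_ge0//; exact/fine_ge0/measure_ge0.
  by rewrite -subset0 => w /= [->].
have jN : (j < N)%N by rewrite -jlN -addSnnS leq_addr.
have mB : measurable [set w | history rd j w = hs /\ A (history rd N w)].
  apply: measurableI; last exact: measurable_history.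
  exact: (measurable_history (fun h => h = hs) (ltnW jN)).
have mrd r : measurable [set w | rd j w = r].
  exact: (round_measurable hrun r jN).
have -> : pr [set w | history rd j w = hs /\ A (history rd N w)] =
    \sum_r pr [set w | (history rd j w = hs /\ A (history rd N w)) /\ rd j w = r].
  rewrite /pr -(fine_measure_fibers P xpredT mB mrd); congr (fine (P _)).
  by apply/seteqP; split => w /= => [|[]].
apply: (@le_trans _ _ (rate ^+ l * \sum_(r : round m n) V (rcons hs r) *
    pr [set w | history rd j w = hs /\ rd j w = r])).
  rewrite mulr_sumr; apply: ler_sum => r _.
  have histE w : (history rd j.+1 w = rcons hs r) <-> (history rd j w = hs /\ rd j w = r).
    by rewrite history_rS; split => [/eqP|[-> ->]//]; rewrite eqseq_rcons => /andP[/eqP-> /eqP->].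
  have := IH j.+1 (rcons hs r); rewrite addSnnS => /(_ jlN).
  rewrite -mulrA; congr (_ <= _ * (_ * _)); congr (fine (P _)); apply/seteqP; split => w /=.
  - by rewrite histE; tauto.
  - by rewrite histE; tauto.
  - by rewrite histE.
  - by rewrite histE.
rewrite exprSr -!mulrA ler_wpM2l ?exprn_ge0 ?rate_ge0//.
by rewrite mulrA odds_step.
Qed.

End Run.

(** * From the odds to the error of the returned estimate *)

Theorem theorem3p1 (R : realType) (n m T : nat)
    (v0 : R) (v p : 'I_n.+1 -> R) (SS : {set {set 'I_n.+1}})
    (eps alpha Pe : R)
    (d : measure_display) (Omega : measurableType d)
    (P : probability Omega R) (rd : nat -> Omega -> round m n)
    (theta : Omega -> R)
    (hv0 : 0 < v0 <= 1)
    (hv : forall i, 0 <= v i <= 1)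
    (hp : forall i, 0 <= p i)
    (hpsorted : forall i j : 'I_n.+1, (i <= j)%N -> p j <= p i)
    (hSS : exists S : {set 'I_n.+1}, S \in SS)
    (hinit : revenue v0 v p [set ord0]%SET <= opt_revenue v0 v p SS)
    (heps : 0 < eps)
    (hm : (0 < m)%N)
    (hgrid : p ord0 * eps^-1 = m%:R)
    (halpha : 0 < alpha < 2^-1)
    (hPe : 0 <= Pe <= alpha)
    (hrun : assort_mnl_bz P T v0 v p SS eps alpha Pe rd)
    (htheta : forall w,
       is_median
         (posterior_dist eps (posterior v0 v p eps alpha (history rd T w)))
         (theta w)) :
  let Qe := 1 - Pe in
  let beta := 1 - alpha in
  let theta_star := opt_revenue v0 v p SS in
  let theta_hat w :=
    Num.max (theta w)
      (revenue v0 v p (best_assortment v0 v p (history rd T w))) in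
  (P [set w | (eps < `|theta_hat w - theta_star|)%R] <=
   ((p ord0 - eps) / eps *
    (Pe / (2 * alpha) + Qe / (2 * beta)) ^+ T)%:E)%E.
Proof.
cbv zeta; set theta_star := opt_revenue _ _ _ _.
have /andP[v0_gt0 _] := hv0.
have v_ge0 i : 0 <= v i by have /andP[] := hv i.
have p0E : p ord0 = eps * m%:R by rewrite -hgrid mulrCA divff ?mulr1// lt0r_neq0.
have p0_gt0 : 0 < p ord0 by rewrite p0E mulr_gt0// ltr0n.
have opt_lt : theta_star < p ord0.
  by apply: opt_revenue_lt => // i; exact: hpsorted.
have /andP[] := truncn_itv (divr_ge0 (opt_revenue_ge0 : 0 <= theta_star) (ltW heps)).
rewrite ler_pdivlMr// ltr_pdivrMr//; set k := Num.truncn _ => k_le lt_k.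
have km : (k < m)%N.
  by rewrite -(ltr_nat R) -(ltr_pM2r heps) [ltRHS]mulrC -p0E; exact: le_lt_trans opt_lt.
(* Here the bin of theta^* is closed on the left, unlike [bin]: if
   [theta_star = eps * k] the correct answer at [eps * k] is yes, and the
   update then favours the bins from [k] on. *)
pose s := Ordinal km.
have s_opt : eps * s%:R <= opt_revenue v0 v p SS < eps * s.+1%:R.
  by rewrite mulrC k_le mulrC.
set E := mkset _.
pose post hs := @posterior R m n v0 v p eps alpha hs.
have post_spec hs : (forall i, 0 < post hs i) /\ \sum_i post hs i = 1.
  exact: (posterior_spec heps hm p0E halpha).
(* Uniqueness of the median makes [E] depend on the history alone, which gives its measurability and
   the form required by [tail_bound]. *)
pose A : set (seq (round m n)) := [set hs | exists2 w, history rd T w = hs & E w].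
have EA : E = [set w | A (history rd T w)].
  apply/seteqP; split => [w Ew|w [w' hist_eq]]; first by exists w.
  have [pos1 sum1] := post_spec (history rd T w).
  have med' : is_median (posterior_dist eps (post (history rd T w))) (theta w').
    by rewrite -hist_eq; exact: htheta.
  by rewrite /E/= hist_eq (median_unique heps pos1 sum1 med' (htheta w)).
(* By contraposition: odds below 1 put the median in bin [s], of length [eps], together with the
   optimum. The best revenue found never exceeds the optimum, so taking the maximum keeps the error
   within [eps]. *)
have A_odds hs : A hs -> 1 <= (post hs s)^-1 - 1.
  move=> [w histw]; apply: contraPle => odds; apply/negP; rewrite -leNgt.
  have [pos1 sum1] := post_spec hs.
  have half_lt : 2^-1 < post hs s.
    by rewrite invf_plt ?posrE//; lra.
  have med := htheta w; rewrite histw in med.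
  have /andP[lo hi] := median_in_bin heps pos1 sum1 half_lt med.
  have best_le := revenue_best_assortment (v0 := v0) (v := v) (p := p) (SS := SS)
    (hs := history rd T w) hinit.
  have {}best_le : revenue v0 v p (best_assortment v0 v p (history rd T w)) <= theta_star.
    apply: best_le => r /mapP[j]; rewrite mem_iota add0n => /andP[_ jT] ->.
    exact: (offered_feasible hrun).
  have /andP[s_le lt_s] := s_opt; rewrite -/theta_star in s_le lt_s.
  rewrite -natr1 mulrDr mulr1 in lt_s hi.
  rewrite /E/= ler_norml.
  by case: (leP (theta w)) => ?; lra.
(* For the empty history the conditioning event is certain, and the initial weight [eps / p ord0]
   yields the factor [(p ord0 - eps) / eps]. *)
have := tail_bound v0_gt0 v_ge0 hp heps hm p0E halpha hPe hrun s_opt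
  [::] A_odds (add0n T).
have mE : measurable E by rewrite EA; exact: (measurable_history hrun).
rewrite (_ : [set w | _ /\ _] = E); last first.
  by rewrite EA; apply/seteqP; split => [w []|].
rewrite (_ : [set w | _ = _] = setT); last by apply/seteqP.
rewrite probability_setT/= mulr1 => bound.
rewrite -(@fineK _ (P E)) ?fin_num_measure// lee_fin; apply: le_trans bound _.
have -> : (p ord0 - eps) / eps = (eps / p ord0)^-1 - 1.
  by rewrite invf_div mulrBl divff ?lt0r_neq0.
by rewrite mulrC.
Qed.
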